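(* Let $\mathcal R$ be a super-algebra and let $M=(M^i_a)_{i\in I,a\in\widetilde I}$ be a family of homogeneous elements $M^i_a\in\mathcal R$ with parities $[M^i_a]=\bar k_i+\bar l_a$. The following are equivalent: (i) for all $s,t\in I$ and $c,d\in\widetilde I$, $\sum_{i,j\in I}\sum_{a,b\in\widetilde I}(-1)^{(\bar k_i+\bar l_a)\bar k_j}B^{st}_{ij}M^i_aM^j_b\widetilde S^{ab}_{cd}=0$ (equivalently, $BM^{(1)}M^{(2)}(1-\widetilde B)=0$ for the operator $M\colon\widetilde W\to W\otimes\mathcal R$, $M\widetilde e_a=\sum_ie_iM^i_a$); (ii) the assignment $f_M(x^i)=\sum_{a\in\widetilde I}M^i_a\widetilde x^a$ extends to a (unique) morphism of $\mathbb N_0$-graded super-algebras $f_M\colon\mathfrak X_B(\mathbb K)\to\mathfrak X_{\widetilde B}(\mathcal R)$; (iii) the assignment $f^M(\widetilde\psi_a)=\sum_{i\in I}\psi_iM^i_a$ extends to a (unique) morphism of $\mathbb N_0$-graded super-algebras $f^M\colon\Xi_{\widetilde B}(\mathbb K)\to\Xi_B(\mathcal R)$. (A matrix satisfying these conditions is called a $(B,\widetilde B)$-Manin matrix.)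
   Context: $\mathbb K$ is an infinite field, $\mathrm{char}\,\mathbb K\ne2$. Let $W,\widetilde W$ be finite-dimensional $\mathbb Z_2$-graded vector spaces with homogeneous bases $(e_i)_{i\in I}$, $(\widetilde e_a)_{a\in\widetilde I}$, parities $[e_i]=\bar k_i$, $[\widetilde e_a]=\bar l_a$. Let $B$ be an even idempotent operator on $W\otimes W$ with entries $B(e_i\otimes e_j)=\sum_{s,t\in I}B^{st}_{ij}e_s\otimes e_t$, $S=1-B$, $S^{st}_{ij}=\delta^s_i\delta^t_j-B^{st}_{ij}$; similarly $\widetilde B$ an even idempotent on $\widetilde W\otimes\widetilde W$ with entries $\widetilde B^{ab}_{cd}$ and $\widetilde S^{ab}_{cd}=\delta^a_c\delta^b_d-\widetilde B^{ab}_{cd}$. $\mathfrak X_B(\mathbb K)$ is the $\mathbb N_0$-graded super-algebra generated by degree-one $x^i$ ($i\in I$) of parity $\bar k_i$ with relations $\sum_{i,j}(-1)^{\bar k_i\bar k_j}B^{st}_{ij}x^ix^j=0$ ($s,t\in I$); $\Xi_B(\mathbb K)$ is generated by degree-one $\psi_i$ of parity $\bar k_i$ with relations $\sum_{s,t}S^{st}_{ij}\psi_s\psi_t=0$ ($i,j\in I$). Analogously $\mathfrak X_{\widetilde B}(\mathbb K)$, $\Xi_{\widetilde B}(\mathbb K)$ with generators $\widetilde x^a$, $\widetilde\psi_a$ of parity $\bar l_a$. For a super-algebra $\mathcal R$, $\mathfrak X_B(\mathcal R)=\mathcal R\otimes\mathfrak X_B(\mathbb K)$, $\Xi_B(\mathcal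 R)=\mathcal R\otimes\Xi_B(\mathbb K)$ (super tensor product of algebras, multiplication $(a\otimes b)(c\otimes d)=(-1)^{[b][c]}ac\otimes bd$, with $\mathcal R$ in degree 0; elements $r\otimes y$ written $ry$). In (i), $M^{(1)},M^{(2)}$ denote $M$ acting in the first/second tensor factor with Koszul signs; the entrywise form of the operator condition is exactly the displayed sum. *)

(* Defs.v *)
From HB Require Import structures.
From mathcomp Require Import all_boot all_order all_algebra.
Set Implicit Arguments.
Unset Strict Implicit.
Unset Printing Implicit Defensive.
Import Order.TTheory GRing.Theory Num.Theory.
Local Open Scope ring_scope.

Definition infinite_field (K : fieldType) : Prop :=
  forall s : seq K, exists x : K, x \notin s.

(* Super-algebras over K (char K <> 2) are encoded by their grading   *)
(* involution sg : R -> R (sg = id on R_0, sg = -id on R_1); an       *)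
(* element r is homogeneous of parity p iff sg r = (-1)^p r.          *)
Definition super_alg (K : fieldType) (R : algType K) (sg : R -> R) : Prop :=
  [/\ forall (a : K) (x y : R), sg (a *: x + y) = a *: sg x + sg y,
      forall x y : R, sg (x * y) = sg x * sg y,
      sg 1 = 1 &
      forall x : R, sg (sg x) = x].

Definition homogeneous (K : fieldType) (R : algType K) (sg : R -> R)
  (p : bool) (r : R) : Prop := sg r = (-1) ^+ p *: r.

(* An even idempotent operator on W (x) W, given by its entries
   B s t i j = B^{st}_{ij}, where B(e_i (x) e_j) = sum_{s,t} B^{st}_{ij} e_s (x) e_t. *)
Definition even_idempotent (K : fieldType) (I : finType) (k : I -> bool)
  (B : I -> I -> I -> I -> K) : Prop :=
  (forall s t i j, B s t i j != 0 -> k s (+) k t = k i (+) k j) /\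
  (forall s t i j, \sum_(p : I) \sum_(q : I) B s t p q * B p q i j = B s t i j).

(* Quadratic super-algebras  R (x) A, where A is the quadratic algebra *)
(* over K with homogeneous generators y_j (j : J) of parity par j and *)
(* relations  rel_{cd} = sum_{a,b} rho c d a b  y_a y_b  = 0.         *)
Record qdata (K : fieldType) := QData {
  qR : algType K;
  qsg : qR -> qR;
  qJ : finType;
  qpar : qJ -> bool;
  qrho : qJ -> qJ -> qJ -> qJ -> K
}.

Section Quadratic.
Variables (K : fieldType) (Q : qdata K).
Local Notation R := (qR Q).
Local Notation J := (qJ Q).

Definition wpar (w : seq J) : bool := odd (count (@qpar _ Q) w).

Definition sgp (b : bool) (r : R) : R := if b then @qsg _ Q r else r.

(* Degree-n component of R (x) T(W): an element  sum_w c(w) y^w     *)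
(* (coefficients written on the left) is the function  w |-> c(w).  *)
Definition Tn (n : nat) := {ffun n.-tuple J -> R}.

(* Product in the super tensor product R (x) T(W):                    *)
(* (r y^u)(r' y^v) = (-1)^{[u][r']} r r' y^{uv} = r sg^{[u]}(r') y^{uv}. *)
Definition mulT m n (c : Tn m) (c' : Tn n) : Tn (m + n) :=
  [ffun w : (m + n).-tuple J =>
     \sum_(u : m.-tuple J) \sum_(v : n.-tuple J)
        if val w == val u ++ val v then c u * sgp (wpar u) (c' v) else 0].

Definition oneT : Tn 0 := [ffun _ => 1].
Definition constT (r : R) : Tn 0 := [ffun _ => r].
Definition genT (j : J) : Tn 1 := [ffun w => if tnth w ord0 == j then 1 else 0].

(* Degree-n part of the two-sided ideal R (x) I, I generated by the   *)
(* relations: finite sums of elements  r y^u rel_{cd} y^v.            *)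
Definition inIdeal (n : nat) (c : Tn n) : Prop :=
  exists ps : seq (R * seq J * J * J * seq J),
    forall w : n.-tuple J,
      c w = \sum_(p <- ps)
              let: (r, u, cc, d, v) := p in
              \sum_(a : J) \sum_(b : J)
                 if val w == u ++ a :: b :: v then @qrho _ Q cc d a b *: r else 0.

Definition eqvT (n : nat) (c c' : Tn n) : Prop := inIdeal (c - c').

Definition homT (p : bool) (n : nat) (c : Tn n) : Prop :=
  forall w : n.-tuple J, homogeneous (@qsg _ Q) (p (+) wpar w) (c w).
Definition classHom (p : bool) (n : nat) (c : Tn n) : Prop :=
  exists c0 : Tn n, eqvT c c0 /\ homT p c0.
End Quadratic.

(* Morphism of N0-graded super-algebras (over K) between the quotients,
   given degreewise on representatives. *)
Definition gsa_morphism (K : fieldType) (Q1 Q2 : qdata K)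
  (f : forall n, Tn Q1 n -> Tn Q2 n) : Prop :=
  [/\ forall n (c c' : Tn Q1 n), eqvT c c' -> eqvT (f n c) (f n c'),
      forall n (a : K) (c c' : Tn Q1 n),
        eqvT (f n (a *: c + c')) (a *: f n c + f n c'),
      forall m n (c : Tn Q1 m) (c' : Tn Q1 n),
        eqvT (f (m + n)%N (mulT c c')) (mulT (f m c) (f n c')),
      eqvT (f 0%N (oneT Q1)) (oneT Q2) &
      forall p n (c : Tn Q1 n), classHom p c -> classHom p (f n c)].

Definition extends_uniquely (K : fieldType) (Q1 Q2 : qdata K)
  (img : qJ Q1 -> Tn Q2 1) : Prop :=
  exists f : forall n, Tn Q1 n -> Tn Q2 n,
    [/\ gsa_morphism f,
        forall j, eqvT (f 1%N (genT j)) (img j) &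
        forall g : forall n, Tn Q1 n -> Tn Q2 n,
          gsa_morphism g -> (forall j, eqvT (g 1%N (genT j)) (img j)) ->
          forall n (c : Tn Q1 n), eqvT (g n c) (f n c)].

Definition Kreg (K : fieldType) : algType K := K^o.

Definition XB (K : fieldType) (R : algType K) (sg : R -> R) (I : finType)
  (k : I -> bool) (B : I -> I -> I -> I -> K) : qdata K :=
  @QData K R sg I k (fun s t i j => (-1) ^+ (k i && k j) * B s t i j).

Definition Smat (K : fieldType) (I : finType) (B : I -> I -> I -> I -> K) :=
  fun s t i j : I => ((s == i) && (t == j))%:R - B s t i j.

Definition XiB (K : fieldType) (R : algType K) (sg : R -> R) (I : finType)
  (k : I -> bool) (B : I -> I -> I -> I -> K) : qdata K :=
  @QData K R sg I k (fun i j s t => Smat B s t i j).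

Arguments oneT {K} Q.
Arguments constT {K} Q r.
Arguments genT {K} Q j.
Arguments XB {K} R sg {I} k B.
Arguments XiB {K} R sg {I} k B.
Arguments extends_uniquely {K} Q1 Q2 img.

(* Main.v *)
Require Import Defs.
From mathcomp Require Import all_boot all_order all_algebra.
From mathcomp Require Import ring.
Import GRing.Theory.
Local Open Scope ring_scope.
Set Implicit Arguments.
Unset Strict Implicit.
Unset Printing Implicit Defensive.

(** A word in the generators of the source is sent to the product of the images
    of its letters, which gives an explicit map [liftT] between the free
    super-algebras; every morphism with the prescribed values on generators
    agrees with it modulo relations, and [liftT] descends to the quotients as
    soon as the quadratic relations are sent into the ideal.  All three
    conditions are thus statements in degree two.  Since [B] and [Bt] are
    idempotent, membership in the degree-two part of the ideal is the vanishing
    of a product with the complementary projector, and the resulting equations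
    are those of (i), in case (iii) up to the sign
    [(-1) ^ ((k s + k t) (1 + l c + l d))], which is constant by evenness. *)

(** * Words as tuples: concatenation and unique splitting *)

Lemma eqseq_catr (T : eqType) (s1 s2 s3 s4 : seq T) :
  size s3 = size s4 -> (s1 ++ s3 == s2 ++ s4) = (s1 == s2) && (s3 == s4).
Proof.
move=> sz34; have [sz12|ne12] := eqVneq (size s1) (size s2).
  exact: eqseq_cat.
have /negPf-> : s1 != s2 by apply: contraNneq ne12 => ->.
apply/eqP=> /(congr1 size)/eqP; rewrite !size_cat sz34 eqn_add2r.
exact/negP.
Qed.

Lemma tval_neqF (T : eqType) n (u v : n.-tuple T) :
  v != u -> (tval u == tval v) = false.
Proof. by move=> ne_vu; apply: contraNF ne_vu => /eqP/val_inj->. Qed.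

Lemma tuple1_ex (T : Type) (w : 1.-tuple T) : exists a, w = [tuple a].
Proof.
by case/tupleP: w => a w; exists a; apply: val_inj; rewrite /= (tuple0 w).
Qed.

Lemma tuple2_ex (T : Type) (w : 2.-tuple T) : exists a b, w = [tuple a; b].
Proof.
case/tupleP: w => a w; have [b ->] := tuple1_ex w.
by exists a, b; apply: val_inj.
Qed.

Lemma cat_tuple_surj (T : Type) m n (w : (m + n).-tuple T) :
  exists (u : m.-tuple T) (v : n.-tuple T), w = cat_tuple u v.
Proof.
have su : size (take m w) == m by rewrite size_takel // size_tuple leq_addr.
have sv : size (drop m w) == n by rewrite size_drop size_tuple addKn.
by exists (Tuple su), (Tuple sv); apply: val_inj; rewrite /= cat_take_drop.
Qed.

Lemma sum_cat_tuple (V : nmodType) (T : finType) m n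
    (F : (m + n).-tuple T -> V) :
  \sum_w F w = \sum_(u : m.-tuple T) \sum_(v : n.-tuple T) F (cat_tuple u v).
Proof.
rewrite pair_big /= (reindex (fun p => cat_tuple p.1 p.2)) //=.
(* Injectivity suffices, since both index sets have [#|T| ^ (m + n)] elements. *)
apply: onW_bij; apply: inj_card_bij => [[u v] [u' v'] /= eq_uv|].
  have: val u ++ val v == val u' ++ val v' by rewrite [_ ++ _](congr1 val eq_uv).
  by rewrite eqseq_cat ?size_tuple // => /andP[/eqP/val_inj-> /eqP/val_inj->].
by rewrite card_prod !card_tuple expnD.
Qed.

Lemma ffun_cat_eqP (T : finType) (V : Type) m n
    (c c' : {ffun (m + n).-tuple T -> V}) :
  (forall u v, c (cat_tuple u v) = c' (cat_tuple u v)) -> c = c'.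
Proof. by move=> eqc; apply/ffunP=> w; have [u [v ->]] := cat_tuple_surj w. Qed.

(** * Homogeneous components and the ideal of relations *)

Section GradedPieces.
Variables (K : fieldType) (Q : qdata K).
Local Notation R := (qR Q).
Local Notation J := (qJ Q).

Lemma wpar_cat (u v : seq J) : wpar (u ++ v) = wpar u (+) wpar v.
Proof. by rewrite /wpar count_cat oddD. Qed.

Lemma wpar_cons a (v : seq J) : wpar (a :: v) = @qpar _ Q a (+) wpar v.
Proof. by rewrite /wpar /= oddD oddb. Qed.

(** A word of length [m + n] splits in only one way into lengths [m] and [n], so the double sum
    defining [mulT] collapses to one term. *)
Lemma mulT_cat m n (c : Tn Q m) (c' : Tn Q n) u v :
  mulT c c' (cat_tuple u v) = c u * sgp (wpar u) (c' v).
Proof.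
rewrite ffunE (bigD1 u) //= (bigD1 v) //= eqxx big1 ?addr0 => [|v' ne_v].
  rewrite big1 ?addr0 // => u' ne_u; rewrite big1 // => v' _.
  by rewrite eqseq_cat ?size_tuple // (tval_neqF ne_u).
by rewrite eqseq_cat // eqxx (tval_neqF ne_v).
Qed.

Lemma genTE a b : genT Q a [tuple b] = (b == a)%:R.
Proof. by rewrite ffunE (tnth_nth b) /=; case: eqP. Qed.

(** The spanning element r y^u rel_{cd} y^v of the ideal, seen in degree [n]. The degree is kept
    independent of the lengths of [u] and [v]; when they do not match, this is zero. *)
Definition monrelT n (r : R) (u : seq J) (c d : J) (v : seq J) : Tn Q n :=
  [ffun w : n.-tuple J => \sum_a \sum_b
     if val w == u ++ a :: b :: v then @qrho _ Q c d a b *: r else 0].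

Lemma monrelT_size n r u c d v :
  n != (size u + (size v).+2)%N -> monrelT n r u c d v = 0.
Proof.
move=> ne_n; apply/ffunP=> w; rewrite !ffunE big1 // => a _; rewrite big1 // => b _.
case: eqP => // /(congr1 size)/eqP.
by rewrite size_tuple size_cat /= (negPf ne_n).
Qed.

Lemma inIdealP n (c : Tn Q n) : inIdeal c <->
  exists ps : seq (R * seq J * J * J * seq J),
    c = \sum_(p <- ps) monrelT n p.1.1.1.1 p.1.1.1.2 p.1.1.2 p.1.2 p.2.
Proof.
split=> -[ps eq_c]; exists ps.
  apply/ffunP=> w; rewrite eq_c sum_ffunE; apply: eq_bigr => -[[[[r u] a] b] v] _.
  by rewrite ffunE.
move=> w; rewrite eq_c sum_ffunE; apply: eq_bigr => -[[[[r u] a] b] v] _.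
by rewrite ffunE.
Qed.

Lemma inIdeal_monrelT n r u c d v : inIdeal (monrelT n r u c d v).
Proof. by apply/inIdealP; exists [:: (r, u, c, d, v)]; rewrite big_seq1. Qed.

Lemma inIdeal0 n : inIdeal (0 : Tn Q n).
Proof. by apply/inIdealP; exists [::]; rewrite big_nil. Qed.

Lemma inIdealD n (c c' : Tn Q n) : inIdeal c -> inIdeal c' -> inIdeal (c + c').
Proof.
move=> /inIdealP[ps ->] /inIdealP[ps' ->].
by apply/inIdealP; exists (ps ++ ps'); rewrite big_cat.
Qed.

Lemma inIdeal_sum n (T : Type) (s : seq T) (F : T -> Tn Q n) :
  (forall i, inIdeal (F i)) -> inIdeal (\sum_(i <- s) F i).
Proof.
by move=> idF; elim/big_ind: _ => //; [exact: inIdeal0 | exact: inIdealD].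
Qed.

Lemma inIdeal_ind n (P : Tn Q n -> Prop) :
  P 0 -> (forall c c', P c -> P c' -> P (c + c')) ->
  (forall r u c d v, P (monrelT n r u c d v)) -> forall c, inIdeal c -> P c.
Proof. by move=> P0 PD Pm c /inIdealP[ps ->]; apply: big_ind. Qed.

Lemma inIdealZ n a (c : Tn Q n) : inIdeal c -> inIdeal (a *: c).
Proof.
move: c; apply: inIdeal_ind => [|c c' Ic Ic'|r u c d v].
- by rewrite scaler0; apply: inIdeal0.
- by rewrite scalerDr; apply: inIdealD.
suff -> : a *: monrelT n r u c d v = monrelT n (a *: r) u c d v.
  exact: inIdeal_monrelT.
apply/ffunP=> w; rewrite !ffunE scaler_sumr; apply: eq_bigr => i _.
rewrite scaler_sumr; apply: eq_bigr => j _; case: ifP => _; last exact: scaler0.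
by rewrite !scalerA mulrC.
Qed.

Lemma inIdealN n (c : Tn Q n) : inIdeal c -> inIdeal (- c).
Proof. by rewrite -scaleN1r; apply: inIdealZ. Qed.

Lemma eqvT_refl n (c : Tn Q n) : eqvT c c.
Proof. by rewrite /eqvT subrr; apply: inIdeal0. Qed.

Lemma eqvT_sym n (c c' : Tn Q n) : eqvT c c' -> eqvT c' c.
Proof. by rewrite /eqvT -[c' - c]opprB; apply: inIdealN. Qed.

Lemma eqvT_trans n (c2 c1 c3 : Tn Q n) : eqvT c1 c2 -> eqvT c2 c3 -> eqvT c1 c3.
Proof. by rewrite /eqvT => I12 /(inIdealD I12); rewrite addrA subrK. Qed.

Lemma eqvT_D n (c1 c2 c1' c2' : Tn Q n) :
  eqvT c1 c1' -> eqvT c2 c2' -> eqvT (c1 + c2) (c1' + c2').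
Proof. by rewrite /eqvT opprD addrACA; apply: inIdealD. Qed.

Lemma eqvT_Z n a (c c' : Tn Q n) : eqvT c c' -> eqvT (a *: c) (a *: c').
Proof. by rewrite /eqvT -scalerBr; apply: inIdealZ. Qed.

(** The flanking words are taken empty, so the bare relations, with coefficients in [R], produce
    [c]. *)
Lemma inIdeal2_span (c : Tn Q 2) (r : J -> J -> R) :
  (forall a b, c [tuple a; b] = \sum_i \sum_j @qrho _ Q i j a b *: r i j) ->
  inIdeal c.
Proof.
move=> eq_c.
suff -> : c = \sum_i \sum_j monrelT 2 (r i j) [::] i j [::].
  apply: inIdeal_sum => i; apply: inIdeal_sum => j; exact: inIdeal_monrelT.
apply/ffunP=> w; have [a [b ->]] := tuple2_ex w.
rewrite eq_c sum_ffunE; apply: eq_bigr => i _; rewrite sum_ffunE.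
apply: eq_bigr => j _; rewrite ffunE (bigD1 a) //= (bigD1 b) //= eqxx.
rewrite !big1 ?addr0 // => [x ne_x|x ne_x].
  by rewrite big1 // => y _; rewrite eqseq_cons eq_sym (negPf ne_x).
by rewrite !eqseq_cons eqxx /= [b == x]eq_sym (negPf ne_x).
Qed.

(** A functional with values in [K] passes through the coefficients in [R], so if it kills the
    relations it kills their combinations. *)
Lemma inIdeal2_orth (c : Tn Q 2) (X : J -> J -> K) :
  (forall i j, \sum_a \sum_b X a b * @qrho _ Q i j a b = 0) ->
  inIdeal c -> \sum_a \sum_b X a b *: c [tuple a; b] = 0.
Proof.
move=> orthX; move: c; apply: inIdeal_ind => [|c c' c0 c'0|r u i j v].
- by rewrite big1 // => a _; rewrite big1 // => b _; rewrite ffunE scaler0.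
- rewrite -[RHS]addr0 -[X in _ = X + _]c0 -[X in _ = _ + X]c'0 -big_split /=.
  apply: eq_bigr => a _.
  by rewrite -big_split /=; apply: eq_bigr => b _; rewrite ffunE scalerDr.
(* A degree-two term can be nonzero only when both flanking words are empty. *)
have [sz_uv|ne_uv] := eqVneq 2%N (size u + (size v).+2)%N; last first.
  rewrite monrelT_size // big1 // => a _; rewrite big1 // => b _.
  by rewrite ffunE scaler0.
move/eqP: sz_uv; rewrite !addnS !eqSS eq_sym addn_eq0 => /andP[/nilP-> /nilP->].
transitivity ((\sum_a \sum_b X a b * @qrho _ Q i j a b) *: r); last first.
  by rewrite orthX scale0r.
rewrite scaler_suml; apply: eq_bigr => a _; rewrite scaler_suml.
apply: eq_bigr => b _; rewrite ffunE (bigD1 a) //= (bigD1 b) //= eqxx.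
rewrite !big1 ?addr0 ?scalerA // => [x ne_x|x ne_x].
  by rewrite big1 // => y _; rewrite eqseq_cons eq_sym (negPf ne_x).
by rewrite !eqseq_cons eqxx /= [b == x]eq_sym (negPf ne_x).
Qed.

(** * Signs from moving coefficients past letters; stability of the ideal under products *)

Section SuperCoefficients.
Hypothesis sgP : super_alg (@qsg _ Q).

Lemma sgp_lin b (a : K) (x y : R) :
  sgp b (a *: x + y) = a *: sgp b x + sgp b y.
Proof. by case: sgP => lin _ _ _; case: b => //=; apply: lin. Qed.

Lemma sgpD b (x y : R) : sgp b (x + y) = sgp b x + sgp b y.
Proof. by have := sgp_lin b 1 x y; rewrite !scale1r. Qed.

Lemma sgp0 b : sgp b (0 : R) = 0.
Proof. by apply: (addrI (sgp b 0)); rewrite -sgpD !addr0. Qed.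

Lemma sgpZ b a (x : R) : sgp b (a *: x) = a *: sgp b x.
Proof. by rewrite -[a *: x]addr0 sgp_lin sgp0 addr0. Qed.

Lemma sgp_sum b (T : Type) (s : seq T) (F : T -> R) :
  sgp b (\sum_(i <- s) F i) = \sum_(i <- s) sgp b (F i).
Proof. exact: (big_morph _ (sgpD b) (sgp0 b)). Qed.

Lemma sgpM b (x y : R) : sgp b (x * y) = sgp b x * sgp b y.
Proof. by case: sgP => _ sgM _ _; case: b => //=; apply: sgM. Qed.

Lemma sgp1 b : sgp b (1 : R) = 1.
Proof. by case: sgP => _ _ sg1 _; case: b. Qed.

Lemma sgpK b b' (x : R) : sgp b (sgp b' x) = sgp (b (+) b') x.
Proof. by case: sgP => _ _ _ sgK; case: b; case: b' => //=; apply: sgK. Qed.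

Lemma sgp_homogeneous b p (x : R) :
  homogeneous (@qsg _ Q) p x -> sgp b x = (-1) ^+ (b && p) *: x.
Proof. by move=> hx; case: b; rewrite ?scale1r. Qed.

Lemma homogeneousM p q (x y : R) :
  homogeneous (@qsg _ Q) p x -> homogeneous (@qsg _ Q) q y ->
  homogeneous (@qsg _ Q) (p (+) q) (x * y).
Proof.
move=> hx hy; rewrite /homogeneous; case: sgP => _ -> _ _.
by rewrite hx hy -scalerAl -scalerAr scalerA signr_addb.
Qed.

Lemma homogeneous_sgp b p (x : R) :
  homogeneous (@qsg _ Q) p x -> homogeneous (@qsg _ Q) p (sgp b x).
Proof.
move=> hx; rewrite (sgp_homogeneous b hx) /homogeneous -[LHS]/(sgp true _) sgpZ /=.
by rewrite hx !scalerA mulrC.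
Qed.

Lemma mulTDl m n (c1 c2 : Tn Q m) (c : Tn Q n) :
  mulT (c1 + c2) c = mulT c1 c + mulT c2 c.
Proof. by apply: ffun_cat_eqP => u v; rewrite [RHS]ffunE !mulT_cat ffunE mulrDl. Qed.

Lemma mulTDr m n (c : Tn Q m) (c1 c2 : Tn Q n) :
  mulT c (c1 + c2) = mulT c c1 + mulT c c2.
Proof.
by apply: ffun_cat_eqP => u v; rewrite [RHS]ffunE !mulT_cat ffunE sgpD mulrDr.
Qed.

Lemma mul0T m n (c : Tn Q n) : mulT (0 : Tn Q m) c = 0.
Proof. by apply: ffun_cat_eqP => u v; rewrite mulT_cat !ffunE mul0r. Qed.

Lemma mulT0 m n (c : Tn Q m) : mulT c (0 : Tn Q n) = 0.
Proof. by apply: ffun_cat_eqP => u v; rewrite mulT_cat !ffunE sgp0 mulr0. Qed.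

(** The words of [c] are absorbed into the left flank [u], while [r] is twisted by the parity of the
    word it crosses. *)
Lemma inIdeal_mulTl m n (c : Tn Q m) (c' : Tn Q n) :
  inIdeal c' -> inIdeal (mulT c c').
Proof.
move: c'; apply: inIdeal_ind => [|c1 c2 I1 I2|r u i j v].
- by rewrite mulT0; apply: inIdeal0.
- by rewrite mulTDr; apply: inIdealD.
suff -> : mulT c (monrelT n r u i j v) =
    \sum_(x : m.-tuple J) monrelT (m + n) (c x * sgp (wpar x) r) (x ++ u) i j v.
  by apply: inIdeal_sum => x; apply: inIdeal_monrelT.
apply: ffun_cat_eqP => x y; rewrite mulT_cat sum_ffunE (bigD1 x) //=.
rewrite [X in _ + X]big1 ?addr0 => [|z ne_z]; rewrite !ffunE.
  rewrite sgp_sum mulr_sumr; apply: eq_bigr => a _.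
  rewrite sgp_sum mulr_sumr; apply: eq_bigr => b _.
  rewrite /= -catA eqseq_cat // eqxx /=; case: ifP => _.
    by rewrite sgpZ scalerAr.
  by rewrite sgp0 mulr0.
rewrite big1 // => a _; rewrite big1 // => b _.
rewrite /= -catA eqseq_cat ?size_tuple //.
by rewrite (tval_neqF ne_z).
Qed.

Hypothesis rho_even : forall c d a b, @qrho _ Q c d a b != 0 ->
  @qpar _ Q c (+) @qpar _ Q d = @qpar _ Q a (+) @qpar _ Q b.

(** A coefficient of [c'] has to cross [u], the relation and [v]. By [rho_even] all monomials of one
    relation have the same parity, so a single twist serves the whole relation. *)
Lemma inIdeal_mulTr m n (c : Tn Q m) (c' : Tn Q n) :
  inIdeal c -> inIdeal (mulT c c').
Proof.
move: c; apply: inIdeal_ind => [|c1 c2 I1 I2|r u i j v].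
- by rewrite mul0T; apply: inIdeal0.
- by rewrite mulTDl; apply: inIdealD.
suff -> : mulT (monrelT m r u i j v) c' =
    \sum_(y : n.-tuple J) monrelT (m + n)
      (r * sgp (wpar u (+) ((@qpar _ Q i (+) @qpar _ Q j) (+) wpar v)) (c' y))
      u i j (v ++ y).
  by apply: inIdeal_sum => x; apply: inIdeal_monrelT.
apply: ffun_cat_eqP => x y; rewrite mulT_cat sum_ffunE (bigD1 y) //=.
rewrite [X in _ + X]big1 ?addr0 => [|z ne_z]; rewrite !ffunE.
  rewrite mulr_suml; apply: eq_bigr => a _.
  rewrite mulr_suml; apply: eq_bigr => b _.
  rewrite /= -!cat_cons catA eqseq_catr // eqxx andbT.
  case: eqP => [->|_]; last exact: mul0r.
  have [->|rho_neq0] := eqVneq (@qrho _ Q i j a b) 0.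
    by rewrite !scale0r mul0r.
  by rewrite -scalerAl wpar_cat !wpar_cons (rho_even rho_neq0) !addbA.
rewrite big1 // => a _; rewrite big1 // => b _.
rewrite /= -!cat_cons catA eqseq_catr ?size_tuple //.
by rewrite (tval_neqF ne_z) andbF.
Qed.

Lemma eqvT_mulT m n (c1 c1' : Tn Q m) (c2 c2' : Tn Q n) :
  eqvT c1 c1' -> eqvT c2 c2' -> eqvT (mulT c1 c2) (mulT c1' c2').
Proof.
move=> I1 I2; have -> : c1 = (c1 - c1') + c1' by rewrite subrK.
have -> : c2 = (c2 - c2') + c2' by rewrite subrK.
rewrite mulTDl [mulT c1' _]mulTDr addrA /eqvT addrK.
by apply: inIdealD; [exact: inIdeal_mulTr | exact: inIdeal_mulTl].
Qed.

End SuperCoefficients.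
End GradedPieces.

(** * The lift of prescribed images of generators to the free super-algebra *)

Section Lift.
Variables (K : fieldType) (J1 : finType) (par1 : J1 -> bool).
Variables (rho1 : J1 -> J1 -> J1 -> J1 -> K) (Q2 : qdata K).
Hypothesis sgP : super_alg (@qsg _ Q2).
Let Q1 := @QData K (Kreg K) id J1 par1 rho1.
Local Notation J2 := (qJ Q2).
Local Notation R := (qR Q2).
Variable img : J1 -> Tn Q2 1.

(* The coefficient of y^v in the product of the images of the letters of w. *)
Fixpoint wcoef (w : seq J1) (v : seq J2) : R :=
  match w, v with
  | [::], [::] => 1
  | i :: w', a :: v' => img i [tuple a] * sgp (@qpar _ Q2 a) (wcoef w' v')
  | _, _ => 0
  end.

Definition liftT n (c : Tn Q1 n) : Tn Q2 n :=
  [ffun v : n.-tuple J2 => \sum_(w : n.-tuple J1) (c w : K) *: wcoef w v].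

Lemma sgp_scalar b (x : qR Q1) : sgp b x = x.
Proof. by case: b. Qed.

(** The coefficient of the second block crosses every letter of [v1], and the successive twists add
    up to the parity of [v1]. *)
Lemma wcoef_cat w1 w2 v1 v2 : size w1 = size v1 ->
  wcoef (w1 ++ w2) (v1 ++ v2) = wcoef w1 v1 * sgp (wpar v1) (wcoef w2 v2).
Proof.
elim: w1 v1 => [|i w1 IHw] [|a v1] //=; first by rewrite mul1r.
by case=> /IHw->; rewrite wpar_cons sgpM // sgpK // mulrA.
Qed.

Lemma liftT_linear n (a : K) (c c' : Tn Q1 n) :
  liftT (a *: c + c') = a *: liftT c + liftT c'.
Proof.
apply/ffunP=> v; rewrite !ffunE scaler_sumr -big_split; apply: eq_bigr => w _ /=.
by rewrite !ffunE scalerDl scalerA.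
Qed.

Lemma liftTD n (c c' : Tn Q1 n) : liftT (c + c') = liftT c + liftT c'.
Proof. by have := liftT_linear 1 c c'; rewrite !scale1r. Qed.

Lemma liftT0 n : liftT (0 : Tn Q1 n) = 0.
Proof. by apply: (addrI (liftT 0)); rewrite -liftTD !addr0. Qed.

Lemma liftTZ n a (c : Tn Q1 n) : liftT (a *: c) = a *: liftT c.
Proof. by rewrite -[a *: c]addr0 liftT_linear liftT0 addr0. Qed.

Lemma liftTB n (c c' : Tn Q1 n) : liftT (c - c') = liftT c - liftT c'.
Proof. by rewrite liftTD -[- c']scaleN1r liftTZ scaleN1r. Qed.

Lemma liftT_sum n (T : Type) (s : seq T) (F : T -> Tn Q1 n) :
  liftT (\sum_(i <- s) F i) = \sum_(i <- s) liftT (F i).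
Proof. exact: (big_morph _ (@liftTD n) (liftT0 n)). Qed.

(** Scalars of the source cross letters without sign, so multiplicativity reduces to [wcoef_cat]. *)
Lemma liftT_mulT m n (c : Tn Q1 m) (c' : Tn Q1 n) :
  liftT (mulT c c') = mulT (liftT c) (liftT c').
Proof.
apply: ffun_cat_eqP => x y; rewrite mulT_cat [LHS]ffunE sum_cat_tuple !ffunE.
rewrite mulr_suml; apply: eq_bigr => u _; rewrite sgp_sum // mulr_sumr.
apply: eq_bigr => v _; rewrite mulT_cat sgp_scalar /= wcoef_cat ?size_tuple //.
by rewrite sgpZ // -scalerAl -scalerAr scalerA.
Qed.

Lemma liftT_one : liftT (oneT Q1) = oneT Q2.
Proof.
apply/ffunP=> v; rewrite (tuple0 v) !ffunE (bigD1 [tuple]) //= ffunE scale1r.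
by rewrite big1 ?addr0 // => w; rewrite (tuple0 w).
Qed.

Lemma liftT_gen j : liftT (genT Q1 j) = img j.
Proof.
apply/ffunP=> v; have [a ->] := tuple1_ex v.
rewrite ffunE (bigD1 [tuple j]) //= (@genTE _ Q1) eqxx scale1r sgp1 // mulr1.
rewrite big1 ?addr0 // => w; have [i ->] := tuple1_ex w => ne_ij.
rewrite (@genTE _ Q1); case: eqP => [eq_ij|_]; last exact: scale0r.
by case/eqP: ne_ij; rewrite eq_ij.
Qed.

(** Words are sorted by their first letter; this drives the induction on the degree in
    [morphism_eqv_liftT]. *)
Lemma gen_expansion n (c : Tn Q1 (1 + n)) :
  c = \sum_i mulT (genT Q1 i) [ffun w => c (cat_tuple [tuple i] w)].
Proof.
apply: ffun_cat_eqP => u v; have [a ->] := tuple1_ex u.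
rewrite sum_ffunE (bigD1 a) // (@mulT_cat _ Q1) (@genTE _ Q1) eqxx mul1r sgp_scalar ffunE.
rewrite big1 => [|i ne_i]; first exact/esym/addr0.
by rewrite (@mulT_cat _ Q1) (@genTE _ Q1) eq_sym (negPf ne_i) mul0r.
Qed.

(** Writing a relation through products of generators lets [liftT] be computed on it by
    multiplicativity. *)
Lemma relT_expansion c d : monrelT (Q := Q1) 2 1 [::] c d [::] =
  \sum_a \sum_b rho1 c d a b *: (mulT (genT Q1 a) (genT Q1 b) : Tn Q1 2).
Proof.
apply: (@ffun_cat_eqP _ _ 1 1) => u v.
have [x ->] := tuple1_ex u; have [y ->] := tuple1_ex v.
rewrite ffunE sum_ffunE; apply: eq_bigr => a _; rewrite sum_ffunE.
apply: eq_bigr => b _; rewrite [RHS]ffunE (@mulT_cat _ Q1 1 1) !(@genTE _ Q1) sgp_scalar /=.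
rewrite !eqseq_cons andbT.
by case: (x == a); case: (y == b); rewrite /= ?mulr1 ?mulr0 ?scaler0.
Qed.

Lemma liftT_rel c d x y :
  liftT (monrelT (Q := Q1) 2 1 [::] c d [::]) [tuple x; y] =
  \sum_a \sum_b rho1 c d a b *:
     (img a [tuple x] * sgp (@qpar _ Q2 x) (img b [tuple y])).
Proof.
rewrite relT_expansion liftT_sum sum_ffunE; apply: eq_bigr => a _.
rewrite liftT_sum sum_ffunE; apply: eq_bigr => b _.
rewrite liftTZ (@liftT_mulT 1 1) [LHS]ffunE !liftT_gen.
rewrite (_ : [tuple x; y] = cat_tuple [tuple x] [tuple y]); last exact: val_inj.
by rewrite (@mulT_cat _ Q2 1 1) wpar_cons addbF.
Qed.

(** * Descent to the quotients and uniqueness of the extension *)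

Hypothesis rho2_even : forall c d a b, @qrho _ Q2 c d a b != 0 ->
  @qpar _ Q2 c (+) @qpar _ Q2 d = @qpar _ Q2 a (+) @qpar _ Q2 b.

(** A spanning element of the ideal is a product of letters, a bare relation and a tail. As [liftT]
    is multiplicative and the target ideal is two-sided, only the image of the bare relation
    matters. *)
Lemma liftT_inIdeal n (c : Tn Q1 n) :
  (forall i j, inIdeal (liftT (monrelT (Q := Q1) 2 1 [::] i j [::]))) ->
  inIdeal c -> inIdeal (liftT c).
Proof.
move=> Irel; move: c; apply: inIdeal_ind => [|c c' Ic Ic'|r u i j v].
- by rewrite liftT0; apply: inIdeal0.
- by rewrite liftTD; apply: inIdealD.
elim: u n => [|h u IHu] n.
  (* Below degree two the element is zero, so the degree may be written [2 + m]. *)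
  have [n2|n2] := leqP 2 n; last first.
    rewrite monrelT_size ?liftT0; first exact: inIdeal0.
    by rewrite neq_ltn (leq_trans n2).
  rewrite -(subnKC n2); set m := (n - 2)%N.
  (* [e] is the monomial r y^v in degree [m]; it vanishes when [v] has another length, and so does
     the element to be factored. *)
  pose e : Tn Q1 m := [ffun w => if val w == v then r else 0].
  suff -> : monrelT (Q := Q1) (2 + m) r [::] i j v =
      mulT (monrelT (Q := Q1) 2 1 [::] i j [::]) e.
    by rewrite liftT_mulT; apply: inIdeal_mulTr.
  apply: ffun_cat_eqP => x y; rewrite mulT_cat sgp_scalar !ffunE mulr_suml.
  apply: eq_bigr => a _; rewrite mulr_suml; apply: eq_bigr => b _ /=.
  rewrite (_ : [:: a, b & v] = [:: a; b] ++ v) // eqseq_cat ?size_tuple //.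
  by do 2!case: eqP => _ /=; rewrite ?mulr0 ?mul0r // [_ *: 1]mulr1.
case: n => [|n].
  by rewrite monrelT_size ?liftT0 //; apply: inIdeal0.
suff -> : monrelT (Q := Q1) (1 + n) r (h :: u) i j v =
    mulT (genT Q1 h) (monrelT n r u i j v).
  by rewrite (@liftT_mulT 1 n); apply: (@inIdeal_mulTl _ _ _ 1 n).
apply: ffun_cat_eqP => x y; have [a ->] := tuple1_ex x.
rewrite mulT_cat (@genTE _ Q1) sgp_scalar !ffunE mulr_sumr.
apply: eq_bigr => b _; rewrite mulr_sumr; apply: eq_bigr => b' _ /=.
by rewrite eqseq_cons; case: eqP => _; rewrite ?mul1r ?mul0r.
Qed.

Hypothesis img_hom : forall i a,
  homogeneous (@qsg _ Q2) (par1 i (+) @qpar _ Q2 a) (img i [tuple a]).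

Lemma wcoef_hom w v : size w = size v ->
  homogeneous (@qsg _ Q2) (wpar (Q := Q1) w (+) wpar v) (wcoef w v).
Proof.
elim: w v => [|i w IHw] [|a v] //=.
  by rewrite /homogeneous scale1r; case: sgP.
case=> /IHw h; rewrite !wpar_cons addbACA.
by apply: homogeneousM => //; apply: homogeneous_sgp.
Qed.

Lemma liftT_homT p n (c : Tn Q1 n) : homT p c -> homT p (liftT c).
Proof.
move=> hc v; rewrite /homogeneous -[LHS]/(sgp true _) ffunE sgp_sum //.
rewrite scaler_sumr; apply: eq_bigr => w _; rewrite sgpZ //= [qsg _]wcoef_hom.
  (* The involution on scalars is the identity, so homogeneity says that [c w] equals its own
     multiple by this sign; inserting the sign trades the parity of [w] for [p]. *)
  have {1}-> : (c w : K) = (-1) ^+ (p (+) wpar (Q := Q1) w) * (c w : K) := hc w.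
  rewrite !scalerA mulrAC -signr_addb.
  by congr ((_ ^+ nat_of_bool _ * _) *: _); rewrite addbA addbK.
by rewrite !size_tuple.
Qed.

(** Induction on the degree: degree zero consists of multiples of the unit, and in higher degree the
    first letter is split off by multiplicativity modulo the ideal. *)
Lemma morphism_eqv_liftT (g : forall n, Tn Q1 n -> Tn Q2 n) :
  gsa_morphism g -> (forall j, eqvT (g 1%N (genT Q1 j)) (img j)) ->
  forall n (c : Tn Q1 n), eqvT (g n c) (liftT c).
Proof.
case=> _ glin gmul g1 _ ggen.
(* [g] is linear only modulo the ideal; the scalar -1 and zero arguments make the right-hand side
   [- g n 0 + g n 0]. *)
have g0 n : eqvT (g n 0) 0.
  have := glin n (-1) 0 0; rewrite scaleN1r oppr0 addr0 scaleN1r addNr.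
  by apply.
have gD n c c' : eqvT (g n (c + c')) (g n c + g n c').
  by have := glin n 1 c c'; rewrite !scale1r.
have gZ n a c : eqvT (g n (a *: c)) (a *: g n c).
  rewrite -[a *: c]addr0; apply: (eqvT_trans (glin _ _ _ _)).
  by rewrite -[X in eqvT _ X]addr0; apply: eqvT_D; [exact: eqvT_refl | ].
elim=> [|n IHn] c.
  have -> : c = c [tuple] *: oneT Q1.
    by apply/ffunP=> w; rewrite (tuple0 w) !ffunE [RHS]mulr1.
  rewrite liftTZ liftT_one; apply: (eqvT_trans (gZ _ _ _)).
  exact: eqvT_Z.
rewrite [c](@gen_expansion n) liftT_sum.
elim/big_rec2: _ => [|i x y _ IHy]; first exact: g0.
apply: (eqvT_trans (gD _ _ _)); apply: eqvT_D => //.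
apply: (eqvT_trans (gmul 1%N n _ _)); rewrite (@liftT_mulT 1 n) liftT_gen.
exact: (@eqvT_mulT _ _ _ _ 1 n).
Qed.

(** Necessity: a morphism agrees with [liftT] modulo the ideal and identifies a relation with zero.
    Sufficiency: [liftT] itself descends, and uniqueness is [morphism_eqv_liftT]. *)
Lemma extends_uniquelyP :
  extends_uniquely Q1 Q2 img <->
  forall i j, inIdeal (liftT (monrelT (Q := Q1) 2 1 [::] i j [::])).
Proof.
split=> [[f [fmor fgen _]] i j | Irel].
  have fE := morphism_eqv_liftT fmor fgen.
  case: fmor => fI _ _ _ _.
  set E := monrelT _ _ _ _ _ _; rewrite -[liftT E]subr0 -(liftT0 2) -/(eqvT _ _).
  apply: (eqvT_trans (eqvT_sym (fE _ _))); apply: (eqvT_trans _ (fE _ _)).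
  by apply: fI; rewrite /eqvT subr0; apply: inIdeal_monrelT.
have lift_eqv n (c c' : Tn Q1 n) : eqvT c c' -> eqvT (liftT c) (liftT c').
  by rewrite /eqvT -liftTB; apply: liftT_inIdeal.
exists liftT; split; last exact: morphism_eqv_liftT.
  split=> //.
  - by move=> n a c c'; rewrite liftT_linear; apply: eqvT_refl.
  - by move=> m n c c'; rewrite liftT_mulT; apply: eqvT_refl.
  - by rewrite liftT_one; apply: eqvT_refl.
  move=> p n c [c0 [eq_c hc0]]; exists (liftT c0); split; first exact: lift_eqv.
  exact: liftT_homT.
by move=> j; rewrite liftT_gen; apply: eqvT_refl.
Qed.

End Lift.

(** * The complementary projector and membership in the ideal in degree two *)

Section Idempotent.
Variables (K : fieldType) (I : finType) (B : I -> I -> I -> I -> K).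

Lemma sum_pair_delta (V : zmodType) (F : I -> I -> V) i j :
  \sum_s \sum_t (if (s == i) && (t == j) then F s t else 0) = F i j.
Proof.
rewrite (bigD1 i) //= (bigD1 j) //= !eqxx /= !big1 ?addr0 //.
  by move=> s /negPf->; rewrite big1.
by move=> t /negPf->.
Qed.

(** The transpose of 1 - B acting on [c]. *)
Lemma sum_Smat_scale (V : lmodType K) (c : I -> I -> V) i j :
  \sum_s \sum_t Smat B s t i j *: c s t =
  c i j - \sum_s \sum_t B s t i j *: c s t.
Proof.
rewrite -(sum_pair_delta c i j) -sumrB; apply: eq_bigr => s _.
rewrite -sumrB; apply: eq_bigr => t _; rewrite scalerBl.
by case: (_ && _); rewrite ?scale1r ?scale0r.
Qed.

(** The operator 1 - B itself acting on [c]. *)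
Lemma sum_scale_Smat (V : lmodType K) (c : I -> I -> V) s t :
  \sum_i \sum_j Smat B s t i j *: c i j =
  c s t - \sum_i \sum_j B s t i j *: c i j.
Proof.
rewrite -(sum_pair_delta c s t) -sumrB; apply: eq_bigr => i _.
rewrite -sumrB; apply: eq_bigr => j _; rewrite scalerBl [s == i]eq_sym [t == j]eq_sym.
by case: (_ && _); rewrite ?scale1r ?scale0r.
Qed.

Lemma Smat_even (k : I -> bool) : even_idempotent k B ->
  forall s t i j, Smat B s t i j != 0 -> k s (+) k t = k i (+) k j.
Proof.
case=> evenB _ s t i j; rewrite /Smat.
case: andP => [[/eqP-> /eqP->] //|_]; rewrite sub0r oppr_eq0; exact: evenB.
Qed.

End Idempotent.

(** Up to the twist (-1)^{k_a k_b}, the relations span the image of the transpose of B, which by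
    idempotency is the kernel of the transpose of 1 - B. *)
Lemma inIdeal2_XB (K : fieldType) (R : algType K) (sg : R -> R) (I : finType)
    (k : I -> bool) (B : I -> I -> I -> I -> K) (c : Tn (XB R sg k B) 2) :
  even_idempotent k B ->
  inIdeal c <-> forall i j : I, \sum_(a : I) \sum_(b : I)
    ((-1) ^+ (k a && k b) * Smat B a b i j) *: c [tuple a; b] = 0.
Proof.
case=> _ idemB; split=> [Ic i j | orth_c].
  apply: (inIdeal2_orth _ Ic) => s t /=.
  transitivity (\sum_a \sum_b Smat B a b i j *: (B s t a b : K^o)).
    apply: eq_bigr => a _; apply: eq_bigr => b _.
    by rewrite mulrACA mulrA -signr_addb addbb mul1r [LHS]mulrC mulrC.
  rewrite sum_Smat_scale -[X in X - _](idemB s t i j); apply/eqP.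
  rewrite subr_eq0; apply/eqP; apply: eq_bigr => a _; apply: eq_bigr => b _.
  exact: mulrC.
(* The twisted coefficients [e] are fixed by the transpose of B, hence serve as their own
   coordinates on the relations. *)
pose e a b : R := (-1) ^+ (k a && k b) *: c [tuple a; b].
apply: (@inIdeal2_span _ (XB R sg k B) c e) => i j /=.
have : \sum_a \sum_b Smat B a b i j *: e a b = 0.
  rewrite -[RHS](orth_c i j); apply: eq_bigr => a _; apply: eq_bigr => b _.
  by rewrite scalerA mulrC.
rewrite sum_Smat_scale.
move/eqP; rewrite subr_eq0 => /eqP/(congr1 ( *:%R ((-1) ^+ (k i && k j)))).
rewrite scalerA -signr_addb addbb scale1r => ->.
rewrite scaler_sumr; apply: eq_bigr => a _; rewrite scaler_sumr.
by apply: eq_bigr => b _; rewrite scalerA.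
Qed.

(** The relations span the image of 1 - B, which is the kernel of B; an element of this kernel is
    its own coordinate vector. *)
Lemma inIdeal2_XiB (K : fieldType) (R : algType K) (sg : R -> R) (I : finType)
    (k : I -> bool) (B : I -> I -> I -> I -> K) (c : Tn (XiB R sg k B) 2) :
  even_idempotent k B ->
  inIdeal c <-> forall s t : I, \sum_(i : I) \sum_(j : I)
    B s t i j *: c [tuple i; j] = 0.
Proof.
case=> _ idemB; split=> [Ic s t | orth_c].
  apply: (inIdeal2_orth _ Ic) => i j /=.
  transitivity (\sum_a \sum_b Smat B a b i j *: (B s t a b : K^o)).
    by apply: eq_bigr => a _; apply: eq_bigr => b _; rewrite mulrC.
  rewrite sum_Smat_scale -[X in X - _](idemB s t i j); apply/eqP.
  rewrite subr_eq0; apply/eqP; apply: eq_bigr => a _; apply: eq_bigr => b _.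
  exact: mulrC.
apply: (@inIdeal2_span _ (XiB R sg k B) c (fun i j => c [tuple i; j])) => s t /=.
by rewrite (sum_scale_Smat B (fun i j => c [tuple i; j])) orth_c subr0.
Qed.

Lemma exchange_big_pairs (V : nmodType) (I J : finType) (F : I -> I -> J -> J -> V) :
  \sum_a \sum_b \sum_i \sum_j F i j a b = \sum_i \sum_j \sum_a \sum_b F i j a b.
Proof.
under eq_bigr do rewrite exchange_big /=.
under eq_bigr do under eq_bigr do rewrite exchange_big /=.
rewrite exchange_big /=; apply: eq_bigr => i _.
exact: exchange_big.
Qed.

(** * Comparison of the three conditions in degree two *)

Theorem mainTheorem14 (K : fieldType) (HKinf : infinite_field K)
  (HK2 : (2%:R : K) != 0)
  (I It : finType) (k : I -> bool) (l : It -> bool)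
  (B : I -> I -> I -> I -> K) (Bt : It -> It -> It -> It -> K)
  (HB : even_idempotent k B) (HBt : even_idempotent l Bt)
  (R : algType K) (sg : R -> R) (HR : super_alg sg)
  (M : I -> It -> R) (HM : forall i a, homogeneous sg (k i (+) l a) (M i a)) :
  let St := Smat Bt in
  let condi :=
    forall (s t : I) (c d : It),
      \sum_(i : I) \sum_(j : I) \sum_(a : It) \sum_(b : It)
        ((-1) ^+ ((k i (+) l a) && k j) * B s t i j * St a b c d)
          *: (M i a * M j b) = 0 in
  let X1 := XB (Kreg K) (@id (Kreg K)) k B in
  let X2 := XB R sg l Bt in
  let condii :=
    extends_uniquely X1 X2
      (fun i => \sum_(a : It) mulT (constT X2 (M i a)) (genT X2 a)) in
  let Y1 := XiB (Kreg K) (@id (Kreg K)) l Bt in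
  let Y2 := XiB R sg k B in
  let condiii :=
    extends_uniquely Y1 Y2
      (fun a => \sum_(i : I) mulT (genT Y2 i) (constT Y2 (M i a))) in
  (condi <-> condii) /\ (condi <-> condiii).
Proof.
move=> St condi X1 X2 condii Y1 Y2 condiii.
have imgX i a : (\sum_(b : It) mulT (constT X2 (M i b)) (genT X2 b)) [tuple a]
    = M i a.
  rewrite (_ : [tuple a] = cat_tuple (nil_tuple It) [tuple a]); last exact: val_inj.
  rewrite sum_ffunE (bigD1 a) // big1 => [|b ne_b]; rewrite (@mulT_cat _ X2 0 1).
    by rewrite (@genTE _ X2) ffunE eqxx mulr1 [LHS]addr0.
  by rewrite (@genTE _ X2) eq_sym (negPf ne_b) mulr0.
(* The sign comes from moving [M i a] to the left of the generator of parity [k i]. *)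
have imgY a i : (\sum_(j : I) mulT (genT Y2 j) (constT Y2 (M j a))) [tuple i]
    = (-1) ^+ (k i && (k i (+) l a)) *: M i a.
  rewrite (_ : [tuple i] = cat_tuple [tuple i] (nil_tuple I)); last exact: val_inj.
  rewrite sum_ffunE (bigD1 i) // big1 => [|j ne_j]; rewrite (@mulT_cat _ Y2 1 0).
    rewrite (@genTE _ Y2) ffunE eqxx mul1r wpar_cons addbF [LHS]addr0.
    exact: (@sgp_homogeneous _ Y2).
  by rewrite (@genTE _ Y2) eq_sym (negPf ne_j) mul0r.
have rhoX_even : forall c d a b, @qrho _ X2 c d a b != 0 ->
    l c (+) l d = l a (+) l b.
  move=> c d a b; case: HBt => evenBt _ /=; rewrite mulf_eq0 negb_or => /andP[_].
  exact: evenBt.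
have rhoY_even : forall c d a b, @qrho _ Y2 c d a b != 0 ->
    k c (+) k d = k a (+) k b.
  by move=> c d a b /(Smat_even HB).
split.
  apply: iff_trans (iff_sym (extends_uniquelyP _ _ _ _)) => //; last first.
    by move=> i a; rewrite imgX; apply: HM.
  (* Here (s,t) labels a relation of the source and (c,d) a test of membership in the target
     ideal. *)
  suff E s t c d : \sum_(a : It) \sum_(b : It)
      ((-1) ^+ (l a && l b) * Smat Bt a b c d) *:
        liftT (rho1 := @qrho _ X1)
        (fun i => \sum_(a : It) mulT (constT X2 (M i a)) (genT X2 a))
        (monrelT (Q := X1) 2 1 [::] s t [::]) [tuple a; b] =
      \sum_(i : I) \sum_(j : I) \sum_(a : It) \sum_(b : It)
        ((-1) ^+ ((k i (+) l a) && k j) * B s t i j * St a b c d)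
          *: (M i a * M j b).
    split=> [Ci s t | IL s t c d].
      by apply: (proj2 (@inIdeal2_XB _ R sg _ _ _ _ HBt)) => c d; rewrite E.
    by rewrite -E; apply: (proj1 (@inIdeal2_XB _ R sg _ _ _ _ HBt)).
  rewrite -exchange_big_pairs; apply: eq_bigr => a _; apply: eq_bigr => b _.
  rewrite liftT_rel //= scaler_sumr; apply: eq_bigr => i _.
  rewrite scaler_sumr; apply: eq_bigr => j _.
  rewrite !imgX (@sgp_homogeneous _ X2 _ _ _ (HM j b)) -scalerAr !scalerA /=.
  congr (_ *: _); rewrite -/(St a b c d).
  (* Crossing gives the exponent l_a (k_j + l_b); adding the twists l_a l_b and k_i k_j leaves (k_i
     + l_a) k_j. *)
  by case: (k i); case: (k j); case: (l a); case: (l b) => /=; ring.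
apply: iff_trans (iff_sym (extends_uniquelyP _ _ _ _)) => //; last first.
  move=> a i; rewrite imgY -(@sgp_homogeneous _ Y2 _ _ _ (HM i a)) addbC.
  exact: homogeneous_sgp.
(* The roles are now exchanged: (c,d) labels the relation and (s,t) the test. The outer sign is
   independent of the summation indices and invertible. *)
suff E s t c d : \sum_(i : I) \sum_(j : I) B s t i j *:
      liftT (rho1 := @qrho _ Y1)
      (fun a => \sum_(i : I) mulT (genT Y2 i) (constT Y2 (M i a)))
      (monrelT (Q := Y1) 2 1 [::] c d [::]) [tuple i; j] =
    (-1) ^+ ((k s (+) k t) && ~~ (l c (+) l d)) *:
    \sum_(i : I) \sum_(j : I) \sum_(a : It) \sum_(b : It)
      ((-1) ^+ ((k i (+) l a) && k j) * B s t i j * St a b c d)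
        *: (M i a * M j b).
  split=> [Ci c d | IL s t c d].
    by apply: (proj2 (@inIdeal2_XiB _ R sg _ _ _ _ HB)) => s t; rewrite E Ci scaler0.
  have := proj1 (@inIdeal2_XiB _ R sg _ _ _ _ HB) (IL c d) s t.
  by rewrite E => /eqP; rewrite scaler_eq0 signr_eq0 => /eqP.
rewrite scaler_sumr; apply: eq_bigr => i _.
rewrite scaler_sumr; apply: eq_bigr => j _.
rewrite liftT_rel //= !scaler_sumr; apply: eq_bigr => a _.
rewrite !scaler_sumr; apply: eq_bigr => b _.
rewrite !imgY (@sgpZ _ Y2) // (@sgp_homogeneous _ Y2 _ _ _ (HM j b)).
rewrite -!scalerAl -!scalerAr !scalerA /=; congr (_ *: _).
(* The signs of the two sides differ by the exponent (k_i + k_j)(1 + l_a + l_b). Where both entries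
   are nonzero, evenness turns it into the one in [E]; otherwise both terms vanish. *)
have [->|B_neq0] := eqVneq (B s t i j) 0; first by ring.
rewrite -/(St a b c d).
have [->|S_neq0] := eqVneq (St a b c d) 0; first by ring.
case: HB => evenB _; rewrite (evenB _ _ _ _ B_neq0) -(Smat_even HBt S_neq0).
by case: (k i); case: (k j); case: (l a); case: (l b) => /=; ring.
Qed.
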